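(* Consider the branch-and-bound enumeration for a convex mixed-integer quadratic program described in the context, with data $Q\succ 0$, $c$, $d$, $A\in\mathbb{R}^{m\times n}$, $b$ and predetermined branching order. After a polynomial time preprocessing, at every node given by a fixing $r=(r_1,\dots,r_\ell)$ at depth $\ell$ the optimal solution $x^\star(r)\in\mathbb{R}^{n-\ell}$ of the continuous relaxation of the reduced problem can be computed from an optimal solution $\lambda^\star(r)\in\mathbb{R}^m$ of its dual problem in $O(m\cdot(n-\ell))$ time per node.
   Context: Problem (MIQP): minimize $f(x)=x^\top Qx+c^\top x+d$ subject to $Ax\le b$, $x_i\in\mathbb{Z}$ for $i=1,\dots,n_1$, $x_i\in\mathbb{R}$ for $i=n_1+1,\dots,n$, where $Q=(q_{ij})\in\mathbb{R}^{n\times n}$ is symmetric positive definite, $c\in\mathbb{R}^n$, $d\in\mathbb{R}$, $A\in\mathbb{R}^{m\times n}$, $b\in\mathbb{R}^m$. Branch-and-bound tree: the integer variables are fixed one at a time in the predetermined order $x_1,x_2,\dots$; a node at depth $\ell\in\{0,\dots,n_1-1\}$ is a fixing $r=(r_1,\dots,r_\ell)\in\mathbb{Z}^\ell$ of the first $\ell$ variables, and for $\ell\ge1$ its parent is $r'=(r_1,\dots,r_{\ell-1})$. The continuous relaxation of the reduced problem at node $r$ is to minimize $x^\top Q_\ell x+c(r)^\top x+d(r)$ subject to $A_\ell x\le b(r)$ over $x\in\mathbb{R}^{n-\ell}$, where $Q_\ell$ arises from $Q$ by deleting the first $\ell$ rows and columns, $A_\ell$ from $A$ by deleting the first $\ell$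 columns, $c(r)_{j-\ell}=c_j+2\sum_{i=1}^\ell q_{ij}r_i$ for $j=\ell+1,\dots,n$, $d(r)=d+\sum_{i=1}^\ell c_ir_i+\sum_{i,j=1}^\ell q_{ij}r_ir_j$, and $b(r)=b-\sum_{i=1}^\ell r_iA_{\cdot,i}$. Its (Lagrangian) dual is $-\min\{\lambda^\top\widetilde Q_\ell\lambda+\widetilde c(r)^\top\lambda+\tilde d(r):\lambda\in\mathbb{R}^m,\lambda\ge0\}$ with $\widetilde Q_\ell=\frac14A_\ell Q_\ell^{-1}A_\ell^\top$, $\widetilde c(r)=\frac12A_\ell Q_\ell^{-1}c(r)+b(r)$, $\tilde d(r)=\frac14c(r)^\top Q_\ell^{-1}c(r)-d(r)$. Running time counts arithmetic operations. ''Preprocessing'' is a computation from the input data $(Q,c,d,A,b,n_1)$ only, done once before the enumeration (including the root node). ''Per node'' time is understood incrementally: auxiliary data can be maintained with each node so that, given the data stored at the parent $r'$, the value $r_\ell$, the preprocessed data and $\lambda^\star(r)$, the desired quantity and the data to be stored at $r$ are computed within the stated time. *)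

(* Defs.v *)
From mathcomp Require Import all_boot all_order all_algebra.
From mathcomp Require Import reals.

Set Implicit Arguments.
Unset Strict Implicit.
Unset Printing Implicit Defensive.

Import Order.TTheory GRing.Theory Num.Theory.
Local Open Scope ring_scope.

(* Minimize x^T Q x + c^T x + d subject to A x <= b, the first n1 of the n
   variables being integer. *)
Record miqp (R : realFieldType) (m n : nat) := Miqp {
  miqpQ : 'M[R]_n;
  miqpc : 'cV[R]_n;
  miqpd : R;
  miqpA : 'M[R]_(m, n);
  miqpb : 'cV[R]_m;
  miqp_n1 : nat
}.

Definition posdef (R : realFieldType) (n : nat) (Q : 'M[R]_n) : Prop :=
  Q^T = Q /\ forall x : 'cV[R]_n, x != 0 -> 0 < (x^T *m Q *m x) 0 0.

Definition quad_fun (R : realFieldType) (n : nat)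
    (Q : 'M[R]_n) (c : 'cV[R]_n) (d : R) (x : 'cV[R]_n) : R :=
  (x^T *m Q *m x) 0 0 + (c^T *m x) 0 0 + d.

Definition is_minimizer (R : realFieldType) (T : Type)
    (feasible : T -> Prop) (f : T -> R) (x : T) : Prop :=
  feasible x /\ forall y, feasible y -> f x <= f y.

Lemma tail_subproof (n l : nat) (i : 'I_(n - l)) : (l + i < n)%N.
Proof. by rewrite -ltn_subRL. Qed.

(* Position, among all n variables, of the i-th variable that is still free
   once the first l variables have been fixed. *)
Definition tail_ord (n l : nat) (i : 'I_(n - l)) : 'I_n :=
  Ordinal (tail_subproof i).

Section ReducedProblem.
Variables (R : realFieldType) (m n : nat) (P : miqp R m n).

Definition Qred (l : nat) : 'M[R]_(n - l) :=
  \matrix_(i, j) miqpQ P (tail_ord i) (tail_ord j).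

Definition Ared (l : nat) : 'M[R]_(m, n - l) :=
  \matrix_(i, j) miqpA P i (tail_ord j).

(* A node is the sequence r of the values fixed so far; its depth is size r. *)
Definition fixval (r : seq int) (i : nat) : R := (nth 0 r i)%:~R.

Definition cred (r : seq int) : 'cV[R]_(n - size r) :=
  \col_j (miqpc P (tail_ord j) 0
    + 2 * \sum_(i < n | (i < size r)%N) miqpQ P i (tail_ord j) * fixval r i).

Definition dred (r : seq int) : R :=
  miqpd P + \sum_(i < n | (i < size r)%N) miqpc P i 0 * fixval r i
  + \sum_(i < n | (i < size r)%N) \sum_(j < n | (j < size r)%N)
      miqpQ P i j * fixval r i * fixval r j.

Definition bred (r : seq int) : 'cV[R]_m :=
  miqpb P - \sum_(i < n | (i < size r)%N) fixval r i *: col i (miqpA P).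

Definition relax_feasible (r : seq int) (x : 'cV[R]_(n - size r)) : Prop :=
  forall i, (Ared (size r) *m x) i 0 <= bred r i 0.

Definition relax_optimal (r : seq int) (x : 'cV[R]_(n - size r)) : Prop :=
  is_minimizer (@relax_feasible r)
    (quad_fun (Qred (size r)) (cred r) (dred r)) x.

Definition Qdual (l : nat) : 'M[R]_m :=
  4^-1 *: (Ared l *m invmx (Qred l) *m (Ared l)^T).

Definition cdual (r : seq int) : 'cV[R]_m :=
  2^-1 *: (Ared (size r) *m invmx (Qred (size r)) *m cred r) + bred r.

Definition ddual (r : seq int) : R :=
  4^-1 * ((cred r)^T *m invmx (Qred (size r)) *m cred r) 0 0 - dred r.

Definition dual_optimal (r : seq int) (lam : 'cV[R]_m) : Prop :=
  is_minimizer (fun mu : 'cV[R]_m => forall i, 0 <= mu i 0)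
    (quad_fun (Qdual (size r)) (cdual r) (ddual r)) lam.

End ReducedProblem.

(* Algorithms are programs of a real random access machine: real numbers are
   stored in multidimensional arrays, addressed by index expressions over
   natural-number inputs and loop counters. The only real constants available
   to a program are integers, so that one and the same program runs on
   instances of all dimensions. *)
Inductive array :=
  | aQ | ac | ad | aA | ab   (* input data *)
  | aPre of nat              (* data produced by the preprocessing *)
  | aParent of nat           (* data stored at the parent node *)
  | aFix                     (* the value of the last fixed variable *)
  | aLambda                  (* the dual solution *)
  | aNode of nat             (* data to be stored at the current node *)
  | aX                       (* the primal solution *)
  | aTmp of nat.             (* working memory *)

Inductive iexp :=
  | IVar of nat
  | INat of nat
  | IAdd of iexp & iexp
  | ISub of iexp & iexp
  | IMul of iexp & iexp.

Inductive rexp :=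
  | RInt of int
  | RCell of array & seq iexp
  | RAdd of rexp & rexp
  | RSub of rexp & rexp
  | RMul of rexp & rexp
  | RDiv of rexp & rexp.

Inductive prog :=
  | Skip
  | Assign of array & seq iexp & rexp
  | Seq of prog & prog
  | IfI of iexp & iexp & prog & prog   (* if e1 <= e2 then p else q *)
  | IfR of rexp & rexp & prog & prog   (* if e1 <= e2 then p else q *)
  | For of nat & iexp & prog.          (* for v = 0, ..., e - 1 do p *)

Definition env := nat -> nat.

Definition set_env (e : env) (v k : nat) : env :=
  fun w => if w == v then k else e w.

Fixpoint ieval (e : env) (a : iexp) : nat :=
  match a with
  | IVar v => e v
  | INat k => k
  | IAdd a1 a2 => (ieval e a1 + ieval e a2)%N
  | ISub a1 a2 => (ieval e a1 - ieval e a2)%N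
  | IMul a1 a2 => (ieval e a1 * ieval e a2)%N
  end.

(* Every read access, constant and operation, on indices as well as on real
   numbers, costs one unit. *)
Fixpoint icost (a : iexp) : nat :=
  match a with
  | IVar _ | INat _ => 1
  | IAdd a1 a2 | ISub a1 a2 | IMul a1 a2 => (icost a1 + icost a2).+1
  end.

Fixpoint rcost (a : rexp) : nat :=
  match a with
  | RInt _ => 1
  | RCell _ idx => (sumn (map icost idx)).+1
  | RAdd a1 a2 | RSub a1 a2 | RMul a1 a2 | RDiv a1 a2 =>
      (rcost a1 + rcost a2).+1
  end.

Section Semantics.
Variable R : realFieldType.

Definition store := array -> seq nat -> R.

Definition array_code (a : array) : nat * nat :=
  match a with
  | aQ => (0, 0) | ac => (1, 0) | ad => (2, 0) | aA => (3, 0) | ab => (4, 0)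
  | aPre k => (5, k) | aParent k => (6, k) | aFix => (7, 0)
  | aLambda => (8, 0) | aNode k => (9, k) | aX => (10, 0) | aTmp k => (11, k)
  end%N.

Definition set_store (s : store) (a : array) (idx : seq nat) (x : R) : store :=
  fun a' idx' =>
    if (array_code a' == array_code a) && (idx' == idx) then x else s a' idx'.

Fixpoint reval (e : env) (s : store) (a : rexp) : R :=
  match a with
  | RInt z => z%:~R
  | RCell a idx => s a (map (ieval e) idx)
  | RAdd a1 a2 => reval e s a1 + reval e s a2
  | RSub a1 a2 => reval e s a1 - reval e s a2
  | RMul a1 a2 => reval e s a1 * reval e s a2
  | RDiv a1 a2 => reval e s a1 / reval e s a2
  end.

(* The final store together with the running time. *)
Fixpoint exec (p : prog) (e : env) (s : store) : store * nat :=
  match p with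
  | Skip => (s, 1%N)
  | Assign a idx x =>
      (set_store s a (map (ieval e) idx) (reval e s x),
       (sumn (map icost idx) + rcost x).+1)
  | Seq p1 p2 =>
      let: (s1, t1) := exec p1 e s in
      let: (s2, t2) := exec p2 e s1 in
      (s2, (t1 + t2)%N)
  | IfI a1 a2 p1 p2 =>
      let: (s1, t1) :=
        if (ieval e a1 <= ieval e a2)%N then exec p1 e s else exec p2 e s in
      (s1, (icost a1 + icost a2 + t1).+1)
  | IfR a1 a2 p1 p2 =>
      let: (s1, t1) :=
        if reval e s a1 <= reval e s a2 then exec p1 e s else exec p2 e s in
      (s1, (rcost a1 + rcost a2 + t1).+1)
  | For v a p1 =>
      iteri (ieval e a)
        (fun i st =>
           let: (s1, t1) := exec p1 (set_env e v i) st.1 in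
           (s1, (st.2 + t1).+1))
        (s, (icost a).+1)
  end.

Definition mx_array (p q : nat) (M : 'M[R]_(p, q)) (idx : seq nat) : R :=
  if idx is [:: i; j] then
    if (insub i, insub j) is (Some i', Some j') then M i' j' else 0
  else 0.

Definition scalar_array (x : R) (idx : seq nat) : R :=
  if idx is [::] then x else 0.

Definition zero_store : store := fun _ _ => 0.

Variables (m n : nat) (P : miqp R m n).

(* Index variables 0, 1, 2, 3 hold m, n, n1 and the depth of the node. *)
Definition input_env (l : nat) : env := nth 0%N [:: m; n; miqp_n1 P; l].

Definition input_store : store := fun a =>
  match a with
  | aQ => mx_array (miqpQ P)
  | ac => mx_array (miqpc P)
  | ad => scalar_array (miqpd P)
  | aA => mx_array (miqpA P)
  | ab => mx_array (miqpb P)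
  | _ => fun _ => 0
  end.

Definition preprocess (pre : prog) : store * nat :=
  exec pre (input_env 0) input_store.

(* The store in which the computation at a node starts: besides the value of
   the last fixed variable and the dual solution, it contains only what the
   preprocessing put into the arrays aPre, and what the computation at the
   parent put into the arrays aNode. In particular all data that the node
   passes on to its children has to be written anew. *)
Definition node_store (pre_st parent_st : store) (v : R) (lam : 'cV[R]_m) :
    store := fun a =>
  match a with
  | aPre k => pre_st (aPre k)
  | aParent k => parent_st (aNode k)
  | aFix => scalar_array v
  | aLambda => mx_array lam
  | _ => fun _ => 0
  end.

(* Computation at the ancestor of depth l of the node r, where lam assigns to
   every node a dual solution. The root has no parent and no fixed variable,
   hence the corresponding arrays are zero. *)
Fixpoint node_comp (node : prog) (pre_st : store) (lam : seq int -> 'cV[R]_m)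
    (r : seq int) (l : nat) : store * nat :=
  match l with
  | 0 => exec node (input_env 0)
           (node_store pre_st zero_store 0 (lam [::]))
  | l'.+1 => exec node (input_env l)
           (node_store pre_st (node_comp node pre_st lam r l').1
              (fixval R r l') (lam (take l r)))
  end.

Definition output (l : nat) (s : store) : 'cV[R]_(n - l) :=
  \col_i s aX [:: i : nat; 0%N].

End Semantics.

(* Main.v *)
Require Import Defs.
From mathcomp Require Import all_boot all_order all_algebra.
From mathcomp Require Import ring lra zify.
From mathcomp Require Import boolp reals.

(** Substituting the stationarity condition 2 Q x = - (c + A^T lambda) of the
    Lagrangian into the dual objective shows that the gradient of that objective
    at lambda is exactly the slack b - A x of the corresponding primal point.
    The first-order conditions of the dual over the nonnegative orthant are
    therefore primal feasibility and complementary slackness of x, which by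
    strict convexity make x the unique primal optimum
    ([quad_dual_primal]).

    At a node of depth l this point is x = y_l + W_l lambda.  Here y_l is the
    unconstrained minimizer of the objective once the first l variables are
    fixed to r, and W_l = - 1/2 Q_l^-1 A_l^T depends on the depth only.  All W_l
    are preprocessed, so that the product W_l lambda costs O(m (n - l)).
    Computing y_l from its definition would cost a product with Q_l^-1, which
    is too expensive when m is small.  Instead, y_l is updated from the parent:
    let w be the vector that vanishes before position k = l - 1, has entry 1 at k
    and is Q-orthogonal to all unit vectors after k.  Moving y_(l-1) along w
    keeps the gradient zero at all positions after k, hence
      y_l = y_(l-1) + (r_k - y_(l-1)[k]) w
    ([tail_min_correct]), which takes O(n - l) operations since w is
    preprocessed as well.

    The same vectors w drive the preprocessing.  If B is the inverse of the
    block of Q after k, padded with zeros, then w = e_k - B Q e_k, and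
    B + w w^T / (e_k^T Q w) is the padded inverse of the block starting at k
    ([inverse_from_border]); e_k^T Q w = w^T Q w is positive.  Starting from
    B = 0, this inverts all trailing blocks in O(n^3) operations.

    On the program side, each cell that a loop fills has a single intended
    value, so that the loop is described by the set of cells it fills ([fills]), and nested
    loops compose by taking unions ([fills_For]).  The running time is bounded
    by a function of the environment alone ([time]), which is polynomial for
    syntactic reasons ([time_le_weight]). *)

Set Implicit Arguments.
Unset Strict Implicit.
Unset Printing Implicit Defensive.

(** * Running time of programs *)

(** Both branches of a comparison of reals are accounted for, hence the value
    does not depend on the store. *)
Fixpoint time (p : prog) (e : env) : nat :=
  match p with
  | Skip => 1
  | Assign _ idx x => (sumn (map icost idx) + rcost x).+1
  | Seq p1 p2 => time p1 e + time p2 e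
  | IfI a1 a2 p1 p2 =>
      (icost a1 + icost a2
       + if ieval e a1 <= ieval e a2 then time p1 e else time p2 e).+1
  | IfR a1 a2 p1 p2 => (rcost a1 + rcost a2 + maxn (time p1 e) (time p2 e)).+1
  | For v a p1 =>
      (icost a).+1 + \sum_(i < ieval e a) (time p1 (set_env e v i)).+1
  end%N.

Lemma exec_time (R : realFieldType) p e (s : store R) :
  ((exec p e s).2 <= time p e)%N.
Proof.
elim: p e s => [|a idx x|p1 IH1 p2 IH2|a1 a2 p1 IH1 p2 IH2
               |a1 a2 p1 IH1 p2 IH2|v b p IHp] e s //=.
- have := IH1 e s; case: (exec p1 e s) => s1 t1 /= le1.
  have := IH2 e s1; case: (exec p2 e s1) => s2 t2 /= le2.
  exact: leq_add.
- case: ifP => _; [have := IH1 e s; case: (exec p1 e s)|have := IH2 e s; case: (exec p2 e s)];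
  move=> s1 t1 /= le1; by rewrite ltnS leq_add2l.
- case: ifP => _; [have := IH1 e s; case: (exec p1 e s)|have := IH2 e s; case: (exec p2 e s)];
  move=> s1 t1 /= le1; by rewrite ltnS leq_add2l leq_max le1 ?orbT.
- elim: (ieval e b) => [|N IHN] /=; first by rewrite big_ord0 addn0.
  rewrite big_ord_recr /=; move: IHN; case: (iteri _ _ _) => s1 t1 /= le1.
  have := IHp (set_env e v N) s1; case: (exec _ _ _) => s2 t2 /= le2.
  by rewrite addnA addnS ltnS leq_add.
Qed.

Fixpoint loops_bounded (N : nat) (p : prog) (e : env) : Prop :=
  match p with
  | Skip | Assign _ _ _ => True
  | Seq p1 p2 | IfI _ _ p1 p2 | IfR _ _ p1 p2 =>
      loops_bounded N p1 e /\ loops_bounded N p2 e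
  | For v a p1 =>
      ieval e a <= N /\
      forall i, i < ieval e a -> loops_bounded N p1 (set_env e v i)
  end.

Fixpoint depth (p : prog) : nat :=
  match p with
  | Skip | Assign _ _ _ => 0
  | Seq p1 p2 | IfI _ _ p1 p2 | IfR _ _ p1 p2 => maxn (depth p1) (depth p2)
  | For _ _ p1 => (depth p1).+1
  end.

Fixpoint weight (p : prog) : nat :=
  match p with
  | Skip => 1
  | Assign _ idx x => (sumn (map icost idx) + rcost x).+1
  | Seq p1 p2 => weight p1 + weight p2
  | IfI a1 a2 p1 p2 => (icost a1 + icost a2 + (weight p1 + weight p2)).+1
  | IfR a1 a2 p1 p2 => (rcost a1 + rcost a2 + (weight p1 + weight p2)).+1
  | For _ a p1 => ((icost a).+1 + (weight p1).+1)
  end.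

(** Each level of loop nesting contributes one factor N, so the nesting depth is
    the degree of the time bound. *)
Lemma time_le_weight N p e : 0 < N -> loops_bounded N p e ->
  time p e <= weight p * N ^ depth p.
Proof.
move=> N_gt0; have Ngt0 d : 0 < N ^ d by rewrite expn_gt0 N_gt0.
have bound2 c w1 d1 w2 d2 :
    c + (w1 * N ^ d1 + w2 * N ^ d2) <= (c + (w1 + w2)) * N ^ maxn d1 d2.
  rewrite !mulnDl leq_add ?leq_pmulr // leq_add // leq_mul // leq_pexp2l //.
    exact: leq_maxl.
  exact: leq_maxr.
elim: p e => [|a idx x|p1 IH1 p2 IH2|a1 a2 p1 IH1 p2 IH2|a1 a2 p1 IH1 p2 IH2
             |v b p IHp] e /=; rewrite ?muln1 //.
- move=> [/IH1 le1 /IH2 le2]; apply: leq_trans (bound2 0 _ _ _ _).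
  by rewrite add0n leq_add.
- move=> [/IH1 le1 /IH2 le2]; apply: leq_trans (bound2 (icost a1 + icost a2).+1 _ _ _ _).
  rewrite addSn ltnS leq_add2l; case: ifP => _.
    by rewrite (leq_trans le1) ?leq_addr.
  by rewrite (leq_trans le2) ?leq_addl.
- move=> [/IH1 le1 /IH2 le2]; apply: leq_trans (bound2 (rcost a1 + rcost a2).+1 _ _ _ _).
  rewrite addSn ltnS leq_add2l geq_max.
  by rewrite (leq_trans le1) ?leq_addr // (leq_trans le2) ?leq_addl.
move=> [le_bN bounded_p]; rewrite mulnDl leq_add ?leq_pmulr //.
apply: (@leq_trans (\sum_(i < ieval e b) (weight p).+1 * N ^ depth p)).
  apply: leq_sum => i _; rewrite mulSn -add1n leq_add //.
  exact/IHp/bounded_p.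
by rewrite sum_nat_const card_ord expnS [leqRHS]mulnCA leq_mul2r le_bN orbT.
Qed.

Import Order.TTheory GRing.Theory Num.Theory.
Local Open Scope ring_scope.

(** * Recovering the primal solution from a dual solution *)

Lemma mx11_tr (R : Type) (M : 'M[R]_1) : M 0 0 = M^T 0 0.
Proof. by rewrite mxE. Qed.

Section Duality.
Variable R : realFieldType.

Lemma quad_funD n (Q : 'M[R]_n) c d x h : Q^T = Q ->
  quad_fun Q c d (x + h) =
  quad_fun Q c d x + ((2 *: (Q *m x) + c)^T *m h) 0 0 + (h^T *m Q *m h) 0 0.
Proof.
move=> symQ; rewrite /quad_fun.
have sym : (h^T *m Q *m x) 0 0 = ((Q *m x)^T *m h) 0 0.
  by rewrite -mulmxA [LHS]mx11_tr trmx_mul trmxK.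
have cross : x^T *m Q *m h = (Q *m x)^T *m h by rewrite trmx_mul symQ.
have D11 (M N : 'M[R]_1) : (M + N) 0 0 = M 0 0 + N 0 0 by rewrite mxE.
have Z11 a (M : 'M[R]_1) : (a *: M) 0 0 = a * M 0 0 by rewrite mxE.
rewrite !linearD /= !mulmxDl linearZ /= -scalemxAl cross.
rewrite !D11 Z11 sym.
ring.
Qed.

(** One-dimensional first-order condition: for small t the linear term decides
    the sign of t g + t^2 q, and negative t are admissible when a > 0. *)
Lemma quad_ge0_slope (q g a : R) : 0 <= a ->
  (forall t, 0 <= a + t -> 0 <= t * g + t ^+ 2 * q) -> 0 <= g /\ a * g = 0.
Proof.
move=> a_ge0 H; have q1_gt0 : 0 < `|q| + 1 by rewrite ltr_wpDl.
have qle : q <= `|q| + 1 by rewrite (le_trans (ler_norm q)) ?lerDl.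
have g_ge0 : 0 <= g.
  rewrite leNgt; apply/negP => g_lt0.
  (* For this t the quadratic term is at most half of the linear one. *)
  pose t := - g / (2 * (`|q| + 1)).
  have t_gt0 : 0 < t by rewrite divr_gt0 ?oppr_gt0 ?mulr_gt0.
  have tE : t * (`|q| + 1) = - g / 2 by rewrite /t; field; rewrite lt0r_neq0.
  have := H t (addr_ge0 a_ge0 (ltW t_gt0)).
  have : t * q <= t * (`|q| + 1) by rewrite ler_wpM2l // ltW.
  rewrite tE; move: t_gt0; clear -g_lt0; nra.
split=> //; apply/eqP; rewrite mulf_eq0; apply/negPn/negP; rewrite negb_or.
case/andP=> a_neq0 g_neq0.
have {}a_gt0 : 0 < a by rewrite lt0r a_neq0.
have {}g_gt0 : 0 < g by rewrite lt0r g_neq0.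
pose t := Num.min a (g / (2 * (`|q| + 1))).
have t_gt0 : 0 < t by rewrite lt_min a_gt0 divr_gt0 ?mulr_gt0.
have t_lea : t <= a by rewrite ge_min lexx.
have tE : t * (`|q| + 1) <= g / 2.
  have -> : g / 2 = g / (2 * (`|q| + 1)) * (`|q| + 1).
    by field; rewrite lt0r_neq0.
  by rewrite ler_wpM2r ?ge_min ?lexx ?orbT // ltW.
have := H (- t); rewrite subr_ge0 => /(_ t_lea).
have : t * q <= t * (`|q| + 1) by rewrite ler_wpM2l // ltW.
move: t_gt0 g_gt0 tE; clear; nra.
Qed.

(** Perturbing a single coordinate of the minimizer reduces the claim to
    [quad_ge0_slope]. *)
Lemma nonneg_quad_kkt m (Q : 'M[R]_m) c d lam : Q^T = Q ->
  is_minimizer (fun mu : 'cV[R]_m => forall i, 0 <= mu i 0)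
    (quad_fun Q c d) lam ->
  forall i, [/\ 0 <= lam i 0, 0 <= (2 *: (Q *m lam) + c) i 0
              & lam i 0 * (2 *: (Q *m lam) + c) i 0 = 0].
Proof.
move=> symQ [lam_ge0 lam_min] i; set g := 2 *: _ + c.
have [||g_ge0 lamg0] := @quad_ge0_slope (Q i i) (g i 0) (lam i 0) => //.
move=> t lamt.
have /lam_min : forall j, 0 <= (lam + t *: delta_mx i 0) j 0.
  move=> j; rewrite !mxE eqxx andbT; have [->|_] := eqVneq j i.
    by rewrite mulr1.
  by rewrite mulr0 addr0.
rewrite quad_funD // -/g -addrA lerDl.
set e : 'cV[R]_m := delta_mx i 0.
have -> : (g^T *m (t *: e)) 0 0 = t * g i 0.
  by rewrite -scalemxAr mxE -colE !mxE.
suff -> : ((t *: e)^T *m Q *m (t *: e)) 0 0 = t ^+ 2 * Q i i by [].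
rewrite -scalemxAr linearZ /= -!scalemxAl -colE trmx_delta -rowE !mxE.
by rewrite mulrA expr2.
Qed.

Lemma posdef_unit n (Q : 'M[R]_n) : posdef Q -> Q \in unitmx.
Proof.
move=> [symQ posQ]; rewrite -row_free_unit -kermx_eq0; apply/eqP/row_matrixP => i.
rewrite row0; apply/eqP/negPn/negP => u_neq0.
have := posQ (row i (kermx Q))^T; rewrite trmx_eq0 => /(_ u_neq0).
by rewrite trmxK -row_mul mulmx_ker row0 mul0mx mxE ltxx.
Qed.

(** The dual gradient at lam is the primal slack at x, so its sign is primal
    feasibility and its products with lam are complementary slackness.  These
    give the bound f x + (y - x)^T Q (y - x) <= f y on the feasible set, from
    which both minimality and uniqueness follow. *)
Lemma quad_dual_primal m n (Q : 'M[R]_n) c d (A : 'M[R]_(m, n)) b d' lam x :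
  posdef Q ->
  is_minimizer (fun mu : 'cV[R]_m => forall i, 0 <= mu i 0)
    (quad_fun (4^-1 *: (A *m invmx Q *m A^T))
       (2^-1 *: (A *m invmx Q *m c) + b) d') lam ->
  2 *: (Q *m x) = - (c + A^T *m lam) ->
  unique (is_minimizer (fun y : 'cV[R]_n => forall i, (A *m y) i 0 <= b i 0)
            (quad_fun Q c d)) x.
Proof.
move=> posQ lam_opt xE; have [symQ Qpos] := posQ.
have Qunit := posdef_unit posQ.
have symD : (4^-1 *: (A *m invmx Q *m A^T))^T = 4^-1 *: (A *m invmx Q *m A^T).
  by rewrite linearZ /= !trmx_mul trmxK trmx_inv symQ mulmxA.
have := nonneg_quad_kkt symD lam_opt; set g := 2 *: _ + _ => kkt.
have gE : g = b - A *m x.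
  have -> : x = 2^-1 *: (invmx Q *m - (c + A^T *m lam)).
    rewrite -xE -scalemxAr mulKmx // scalerA mulVf ?scale1r //.
    by rewrite pnatr_eq0.
  rewrite /g mulmxN scalerN mulmxN opprK mulmxDr scalerDr mulmxDr.
  rewrite -!scalemxAl -!scalemxAr !mulmxA scalerA.
  have -> : 2 / 4 = 2^-1 :> R by field.
  by rewrite [RHS]addrC -[RHS]addrA [RHS]addrCA.
have slack i : g i 0 = b i 0 - (A *m x) i 0 by rewrite gE !mxE.
have gap y : (forall i, (A *m y) i 0 <= b i 0) ->
  quad_fun Q c d x + ((y - x)^T *m Q *m (y - x)) 0 0 <= quad_fun Q c d y.
  move=> y_feas; have := quad_funD c d x (y - x) symQ.
  rewrite [x + _]addrC subrK => ->; rewrite lerD2r lerDl xE opprD addrAC addNr add0r.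
  rewrite linearN /= trmx_mul trmxK.
  rewrite mulNmx -mulmxA mulmxBr -linearN /= opprB !mxE.
  apply: sumr_ge0 => i _; rewrite !mxE.
  have [lam0 _ compl] := kkt i.
  rewrite -[X in 0 <= X]addr0 -[X in _ + X]compl slack.
  rewrite !mxE -mulrDr mulr_ge0 //.
  have := y_feas i; rewrite !mxE; lra.
have x_feas i : (A *m x) i 0 <= b i 0.
  by have [_] := kkt i; rewrite slack subr_ge0.
have quad_ge0 (h : 'cV[R]_n) : 0 <= (h^T *m Q *m h) 0 0.
  have [->|h_neq0] := eqVneq h 0; last exact/ltW/Qpos.
  by rewrite mulmx0 mxE.
split.
  by split=> // y /gap; apply: le_trans; rewrite lerDl.
move=> y [y_feas y_min]; apply/eqP; rewrite eq_sym -subr_eq0.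
apply/negPn/negP => /Qpos; rewrite ltNge => /negP[].
by have := le_trans (gap y y_feas) (y_min x x_feas); rewrite gerDl.
Qed.

End Duality.

(** * Inverses of the trailing blocks *)

Section Elimination.
Variables (R : realFieldType) (n : nat) (Q : 'M[R]_n).

Definition unit_vec (k : nat) : 'cV[R]_n := \col_i ((i : nat) == k)%:R.

(** When B is the zero-padded inverse of the block of Q after position k, this
    is the vector with entry 1 at k and 0 before that is Q-orthogonal to all unit
    vectors after k. *)
Definition conj_dir (B : 'M[R]_n) (k : nat) : 'cV[R]_n :=
  unit_vec k - B *m (Q *m unit_vec k).

Definition curvature (k : nat) (w : 'cV[R]_n) : R :=
  ((unit_vec k)^T *m (Q *m w)) 0 0.

(** Extending the block by row and column k is a rank-one update of the padded
    inverse: the new direction w is Q-orthogonal to the old block, so the two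
    inverses simply add up. *)
Definition border_inv (B : 'M[R]_n) (k : nat) : 'M[R]_n :=
  let w := conj_dir B k in B + (curvature k w)^-1 *: (w *m w^T).

(** The argument t is the size of the trailing block.  All inverses are padded
    to n x n, which keeps them in one type. *)
Fixpoint tail_inv (t : nat) : 'M[R]_n :=
  if t is t'.+1 then border_inv (tail_inv t') (n - t) else 0.

Definition tail_dir (t : nat) : 'cV[R]_n := conj_dir (tail_inv t) (n - t.+1).

(** This says that B is the inverse of the block of Q on the indices i >= l,
    padded with zeros: the last condition is Q B = 1 on the rows of the block,
    and the columns outside it vanish by symmetry. *)
Definition inverse_from (l : nat) (B : 'M[R]_n) : Prop :=
  [/\ B^T = B, forall i j : 'I_n, (i < l)%N -> B i j = 0
    & forall i j : 'I_n, (l <= i)%N -> (Q *m B) i j = (i == j)%:R].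

Lemma mul_unit_vec p (M : 'M[R]_(p, n)) (k : 'I_n) : M *m unit_vec k = col k M.
Proof.
by rewrite colE; congr (_ *m _); apply/matrixP => i j; rewrite !mxE ord1 andbT.
Qed.

Lemma curvatureE (k : 'I_n) w : curvature k w = (Q *m w) k 0.
Proof. by rewrite /curvature [LHS]mx11_tr trmx_mul trmxK mul_unit_vec !mxE. Qed.

Hypothesis posQ : posdef Q.

Section Step.
Variables (k : 'I_n) (B : 'M[R]_n).
Hypothesis invB : inverse_from k.+1 B.
Let w := conj_dir B k.

Lemma conj_dir_head (i : 'I_n) : (i <= k)%N -> w i 0 = (i == k)%:R.
Proof.
have [_ B0 _] := invB; move=> le_ik; rewrite /w !mxE big1 ?subr0 // => j _.
by rewrite B0 ?mul0r.
Qed.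

Lemma conj_dir_tail (i : 'I_n) : (k < i)%N -> (Q *m w) i 0 = 0.
Proof.
have [_ _ QB] := invB; move=> lt_ki.
rewrite /w /conj_dir mulmxBr (mulmxA Q) [LHS]mxE [X in _ + X]mxE.
apply/eqP; rewrite subr_eq0; apply/eqP.
rewrite [RHS]mxE (bigD1 i) //= QB // eqxx mul1r big1 ?addr0 // => j ne_ji.
by rewrite QB // eq_sym (negPf ne_ji) mul0r.
Qed.

(** By symmetry, row k of Q B is column k of B Q, which is the part subtracted
    in the definition of w. *)
Lemma mulmxB_row (j : 'I_n) : (Q *m B) k j = (k == j)%:R - w j 0.
Proof.
have [symB _ _] := invB; have [symQ _] := posQ.
rewrite /w /conj_dir mulmxA mul_unit_vec !mxE [(j : nat) == k]eq_sym.
rewrite opprD opprK addNKr.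
apply: eq_bigr => h _.
by rewrite mulrC -[in RHS]symB -[in RHS]symQ !mxE.
Qed.

(** Q w vanishes after k and w vanishes before k, so e_k^T Q w equals
    w^T Q w, and w is nonzero because w_k = 1. *)
Lemma conj_dir_curvature_gt0 : 0 < curvature k w.
Proof.
have [_ pos] := posQ.
have wk : w k 0 = 1 by rewrite conj_dir_head ?eqxx.
have w_neq0 : w != 0.
  by apply: contra_eq_neq wk => ->; rewrite mxE eq_sym oner_neq0.
have := pos w w_neq0; rewrite curvatureE -mulmxA mxE (bigD1 k) //= [w^T _ _]mxE.
rewrite wk mul1r big1 ?addr0 // => i ne_ik; rewrite [w^T _ _]mxE.
have [lt_ki|le_ik] := ltnP k i; first by rewrite conj_dir_tail ?mulr0.
by rewrite conj_dir_head // (negPf ne_ik) mul0r.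
Qed.

Lemma inverse_from_border : inverse_from k (border_inv B k).
Proof.
have [symB B0 QB] := invB; rewrite /border_inv -/w.
have s_gt0 := conj_dir_curvature_gt0; set s := curvature k w in s_gt0 *.
have wwE i j : (w *m w^T) i j = w i 0 * w j 0.
  by rewrite mxE big_ord1 !mxE.
split.
- by rewrite linearD linearZ /= trmx_mul trmxK symB.
- move=> i j lt_ik; rewrite mxE [X in _ + X]mxE wwE B0 ?(leqW lt_ik) //.
  by rewrite conj_dir_head ?(ltnW lt_ik) // -val_eqE ltn_eqF // mul0r mulr0 addr0.
move=> i j le_ki.
have -> : (Q *m (B + s^-1 *: (w *m w^T))) i j
   = (Q *m B) i j + s^-1 * ((Q *m w) i 0 * w j 0).
  rewrite mulmxDr -scalemxAr mulmxA mxE [X in _ + X]mxE.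
  by rewrite [X in _ * X]mxE big_ord1 [w^T _ _]mxE.
move: le_ki; rewrite leq_eqVlt => /orP[/eqP/val_inj <-|lt_ki].
  by rewrite mulmxB_row -curvatureE -/s mulKf ?lt0r_neq0 // subrK.
by rewrite QB // conj_dir_tail // mul0r mulr0 addr0.
Qed.

End Step.

Lemma tail_inv_correct t : (t <= n)%N -> inverse_from (n - t) (tail_inv t).
Proof.
elim: t => [_|t IHt lt_tn].
  split=> [|i j _|i j]; rewrite ?trmx0 ?mxE //.
  by rewrite subn0 leqNgt ltn_ord.
have lt_kn : (n - t.+1 < n)%N by lia.
apply: (@inverse_from_border (Ordinal lt_kn)).
by rewrite /= subnSK // ; apply: IHt; apply: ltnW.
Qed.

Variables (c : 'cV[R]_n) (v : nat -> R).

(** Full-length vectors: the first l entries are the fixed values v, the others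
    minimize the objective given these.  Fixing one more variable moves along
    the direction that leaves the partial derivatives at the later positions
    unchanged. *)
Fixpoint tail_min (l : nat) : 'cV[R]_n :=
  if l is l'.+1 then
    let y := tail_min l' in
    y + (v l' - ((unit_vec l')^T *m y) 0 0) *: tail_dir (n - l)
  else - 2^-1 *: (tail_inv n *m c).

Lemma unit_vec_coord (k : 'I_n) (y : 'cV[R]_n) :
  ((unit_vec k)^T *m y) 0 0 = y k 0.
Proof. by rewrite [LHS]mx11_tr trmx_mul trmxK mul_unit_vec !mxE. Qed.

Lemma tail_min_correct l : (l <= n)%N ->
  (forall i : 'I_n, (i < l)%N -> tail_min l i 0 = v i) /\
  (forall i : 'I_n, (l <= i)%N -> 2 * (Q *m tail_min l) i 0 = - c i 0).
Proof.
elim: l => [_|l IHl lt_ln].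
  split=> // i _; have [_ _ QB] := tail_inv_correct (leqnn n).
  rewrite subnn in QB; rewrite /tail_min -scalemxAr mulmxA.
  have -> : Q *m tail_inv n = 1%:M by apply/matrixP => h j; rewrite QB // !mxE.
  by rewrite mul1mx mxE mulrA mulrN divff ?mulN1r // pnatr_eq0.
have [head tail] := IHl (ltnW lt_ln).
pose k := Ordinal lt_ln.
have kE : (n - (n - l.+1).+1)%N = k by rewrite /=; lia.
have inv : inverse_from k.+1 (tail_inv (n - l.+1)).
  have := @tail_inv_correct (n - l.+1) (leq_subr _ _).
  by rewrite subKn.
rewrite /= /tail_dir kE -[l]/(val k) unit_vec_coord; set y := tail_min k in head tail *.
split=> i.
  rewrite ltnS => le_ik; rewrite !mxE -/(conj_dir _ _).
  have := conj_dir_head inv le_ik; rewrite /conj_dir !mxE => ->.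
  move: le_ik; rewrite leq_eqVlt => /orP[/eqP/val_inj ->|lt_ik].
    by rewrite eqxx mulr1 addrC subrK.
  by rewrite -val_eqE ltn_eqF // mulr0 addr0 head.
move=> lt_ki; rewrite mulmxDr -scalemxAr.
rewrite mxE [X in _ + X]mxE (conj_dir_tail inv) // mulr0 addr0.
by apply: tail; apply: ltnW.
Qed.

End Elimination.

(** * Optimality at a node *)

Lemma sum_head_tail (V : nmodType) (n l : nat) (F : 'I_n -> V) :
  \sum_i F i = \sum_(i < n | (i < l)%N) F i + \sum_(i < n - l) F (tail_ord i).
Proof.
rewrite (bigID (fun i : 'I_n => (i < l)%N)) /=; congr (_ + _).
rewrite (reindex_omap (@tail_ord n l) (fun i => insub (i - l)%N)) /=.
  apply: eq_bigl => j; rewrite -leqNgt leq_addr /= addKn valK eqxx //.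
move=> i; rewrite -leqNgt => le_li.
have lt_il : (i - l < n - l)%N by rewrite ltn_sub2r // (leq_ltn_trans le_li).
by rewrite insubT /=; congr Some; apply: val_inj; rewrite /= subnKC.
Qed.

(** Writing the reduced data as products with this matrix makes positive
    definiteness of the reduced matrix a special case of that of Q. *)
Definition embed_tail (R : realFieldType) (n l : nat) : 'M[R]_(n, n - l) :=
  \matrix_(i, j) (i == tail_ord j)%:R.

Lemma tail_ord_inj n l : injective (@tail_ord n l).
Proof. by move=> i j /(congr1 val)/addnI/val_inj. Qed.

Lemma mul_embed_tail (R : realFieldType) p n l (M : 'M[R]_(p, n)) i (j : 'I_(n - l)) :
  (M *m embed_tail R n l) i j = M i (tail_ord j).
Proof.
rewrite mxE (bigD1 (tail_ord j)) //= mxE eqxx mulr1 big1 ?addr0 // => h ne_h.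
by rewrite mxE (negPf ne_h) mulr0.
Qed.

Section Node.
Variables (R : realFieldType) (m n : nat) (P : miqp R m n).
Hypothesis posQ : posdef (miqpQ P).

Definition dual_map (t : nat) : 'M[R]_(n, m) :=
  - 2^-1 *: (tail_inv (miqpQ P) t *m (miqpA P)^T).

Lemma Qred_posdef l : posdef (Qred P l).
Proof.
have [symQ pos] := posQ; set E := embed_tail R n l.
have QE : Qred P l = E^T *m miqpQ P *m E.
  apply/matrixP => i j; rewrite mul_embed_tail [LHS]mxE.
  by rewrite -symQ -trmx_mul [RHS]mxE mul_embed_tail mxE.
split; first by rewrite QE !trmx_mul trmxK symQ mulmxA.
move=> x x_neq0; rewrite QE.
have -> : x^T *m (E^T *m miqpQ P *m E) *m x = (E *m x)^T *m miqpQ P *m (E *m x).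
  by rewrite trmx_mul !mulmxA.
apply: pos; apply: contra_neq x_neq0 => Ex0.
have <- : E^T *m (E *m x) = x; last by rewrite Ex0 mulmx0.
have EE : E^T *m E = 1%:M.
  apply/matrixP => i j; rewrite mul_embed_tail !mxE eq_sym.
  by rewrite (inj_eq (@tail_ord_inj n l)).
by rewrite mulmxA EE mul1mx.
Qed.

(** The first l entries of W lam are zero and those of the unconstrained
    minimizer are the fixed values.  Splitting Q y into fixed and free columns therefore
    produces exactly the linear term of the reduced problem, and the two parts
    add up to the stationarity condition required by [quad_dual_primal]. *)
Lemma relax_optimal_from_dual (r : seq int) (lam : 'cV[R]_m)
    (x : 'cV[R]_(n - size r)) :
  (size r <= n)%N -> dual_optimal P r lam ->
  (forall i, x i 0 =
     tail_min (miqpQ P) (miqpc P) (fixval R r) (size r) (tail_ord i) 0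
     + (dual_map (n - size r) *m lam) (tail_ord i) 0) ->
  unique (@relax_optimal R m n P r) x.
Proof.
move=> le_rn lam_opt xE.
have := quad_dual_primal (dred P r) (Qred_posdef _) lam_opt.
apply.
set l := size r in x xE le_rn *.
set y := tail_min _ _ _ _ in xE; set z := _ *m lam in xE.
have [y_head y_tail] := tail_min_correct posQ (miqpc P) (fixval R r) le_rn.
rewrite -/y in y_head y_tail.
have [_ B0 QB] := tail_inv_correct posQ (leq_subr l n).
rewrite subKn // in B0 QB.
have z_head (i : 'I_n) : (i < l)%N -> z i 0 = 0.
  move=> lt_il; rewrite /z /dual_map -scalemxAl mxE -mulmxA mxE big1 ?mulr0 //.
  by move=> h _; rewrite B0 ?mul0r.
have z_tail (i : 'I_n) : (l <= i)%N ->
    2 * (miqpQ P *m z) i 0 = - ((miqpA P)^T *m lam) i 0.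
  move=> le_li; rewrite /z /dual_map -scalemxAl -scalemxAr -mulmxA (mulmxA (miqpQ P)) mxE.
  rewrite mulrA mulrN divff ?pnatr_eq0 // mulN1r; congr (- _).
  rewrite mxE (bigD1 i) //= QB // eqxx mul1r big1 ?addr0 // => h ne_hi.
  by rewrite QB // eq_sym (negPf ne_hi) mul0r.
apply/colP => i; have le_li : (l <= tail_ord i)%N by apply: leq_addr.
have := y_tail _ le_li; have := z_tail _ le_li.
rewrite [(_ *m z) _ _]mxE [(_ *m y) _ _]mxE !(@sum_head_tail _ n l).
rewrite big1 => [|h lt_hl]; last by rewrite z_head ?mulr0.
rewrite add0r => Ez Ey.
have -> : (2 *: (Qred P l *m x)) i 0 =
    2 * (\sum_(h < n - l) miqpQ P (tail_ord i) (tail_ord h) * y (tail_ord h) 0)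
  + 2 * (\sum_(h < n - l) miqpQ P (tail_ord i) (tail_ord h) * z (tail_ord h) 0).
  rewrite mxE -mulrDr -big_split mxE; congr (_ * _); apply: eq_bigr => h _ /=.
  by rewrite mxE xE mulrDr.
have -> : (- (cred P r + (Ared P l)^T *m lam)) i 0 =
    - (miqpc P (tail_ord i) 0 + 2 * \sum_(h < n | (h < l)%N)
         miqpQ P (tail_ord i) h * y h 0) - ((miqpA P)^T *m lam) (tail_ord i) 0.
  rewrite !mxE opprD; congr (- (_ + 2 * _) - _).
    apply: eq_bigr => h lt_hl; rewrite y_head //; congr (_ * _).
    by have [symQ _] := posQ; rewrite -{1}symQ mxE.
  by apply: eq_bigr => h _; rewrite !mxE.
rewrite Ez; congr (_ + _).
by apply/eqP; rewrite opprD -Ey mulrDr [X in _ == X - _]addrC addrK.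
Qed.

End Node.

(** * Effect of loops on the store *)

Section Writes.
Variable R : realFieldType.
Implicit Types (s : store R) (f : seq nat -> R) (D : pred (seq nat)).

Definition write s a D f : store R := fun a' x =>
  if (array_code a' == array_code a) && D x then f x else s a' x.

Lemma write_set s a D f idx x : x = f idx ->
  set_store (write s a D f) a idx x = write s a (predU D (pred1 idx)) f.
Proof.
move=> ->; apply/funext => a'; apply/funext => y; rewrite /set_store /write /=.
by case: eqP => //= _; case: eqP => [->|_]; rewrite ?orbT ?orbF.
Qed.

Lemma set_storeK s a idx x y :
  set_store (set_store s a idx x) a idx y = set_store s a idx y.
Proof.
apply/funext => a'; apply/funext => z; rewrite /set_store.
by case: ifP => // ->.
Qed.

Lemma exec_Seq p q e s : (exec (Seq p q) e s).1 = (exec q e (exec p e s).1).1.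
Proof. by rewrite /=; case: (exec p e s) => s1 t1 /=; case: (exec q e s1). Qed.

Lemma exec_For_ind v b p e s (I : nat -> store R -> Prop) :
  I 0%N s ->
  (forall i s', (i < ieval e b)%N -> I i s' ->
     I i.+1 (exec p (set_env e v i) s').1) ->
  I (ieval e b) (exec (For v b p) e s).1.
Proof.
move=> I0 IS /=; set F := (X in iteri _ X _); set st0 := (X in iteri _ _ X).
suff IN N : (N <= ieval e b)%N -> I N (iteri N F st0).1 by apply: IN.
elim: N => [|i IHi] //= lt_ib; have := IS i _ lt_ib (IHi (ltnW lt_ib)).
by rewrite {2}/F; case: (exec p _ _).
Qed.

(** The array f holds the intended final contents of a, and D the cells written.
    Quantifying over the cells D' that already have their intended value lets
    the loop rule chain the iterations of a body without tracking an
    order among them. *)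
Definition fills p e s a D f :=
  forall D', (exec p e (write s a D' f)).1 = write s a (predU D' D) f.

Lemma fills_exec p e s a D f :
  fills p e s a D f -> (exec p e s).1 = write s a D f.
Proof.
have E : write s a pred0 f = s.
  by apply/funext => a'; apply/funext => x; rewrite /write andbF.
by move=> fills_p; rewrite -{1}E fills_p.
Qed.

Lemma fills_For v b p e s a (D : nat -> pred (seq nat)) f :
  (forall i, (i < ieval e b)%N -> fills p (set_env e v i) s a (D i) f) ->
  fills (For v b p) e s a
    (fun x => [exists i : 'I_(ieval e b), D i x]) f.
Proof.
move=> fill_p D'.
pose Dto N x := D' x || [exists i : 'I_N, D i x].
apply: (@exec_For_ind v b p e _ (fun N s' => s' = write s a (Dto N) f)).
  apply/funext => a'; apply/funext => x; rewrite /write /Dto.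
  suff -> : [exists i : 'I_0, D i x] = false by rewrite orbF.
  by apply/existsP => -[[]].
move=> N s' lt_N ->; rewrite fill_p //.
apply/funext => a'; apply/funext => x; rewrite /write /Dto /= -orbA.
suff -> : [exists i : 'I_N, D i x] || D N x = [exists i : 'I_N.+1, D i x] by [].
apply/orP/existsP => [[/existsP[i Di]|DN]|[i Di]].
- by exists (widen_ord (leqnSn N) i).
- by exists ord_max.
have [lt_iN|le_Ni] := ltnP i N; first by left; apply/existsP; exists (Ordinal lt_iN).
by right; have <- : val i = N by apply/eqP; rewrite eqn_leq le_Ni -ltnS ltn_ord.
Qed.

Lemma fills_Assign a idx x e s f :
  (forall D', reval e (write s a D' f) x = f (map (ieval e) idx)) ->
  fills (Assign a idx x) e s a (pred1 (map (ieval e) idx)) f.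
Proof. by move=> xE D'; apply: write_set. Qed.

Lemma fills_IfI a1 a2 p1 p2 e s a D f :
  ((ieval e a1 <= ieval e a2)%N -> fills p1 e s a D f) ->
  ((ieval e a2 < ieval e a1)%N -> fills p2 e s a D f) ->
  fills (IfI a1 a2 p1 p2) e s a D f.
Proof.
move=> fill1 fill2 D' /=; case: leqP => [/fill1 <-|/fill2 <-].
  by case: (exec p1 _ _).
by case: (exec p2 _ _).
Qed.

(** The sum is accumulated in its target cell, which holds partial sums
    meanwhile; the hypotheses of [exec_sum] ask that the summands do not depend
    on that cell. *)
Definition sum_prog v b a idx x0 x :=
  Seq (Assign a idx x0) (For v b (Assign a idx (RAdd (RCell a idx) x))).

Lemma exec_sum v b a idx x0 x e s (F : nat -> R) :
  (forall i, map (ieval (set_env e v i)) idx = map (ieval e) idx) ->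
  (forall i z, (i < ieval e b)%N -> reval (set_env e v i)
      (set_store s a (map (ieval e) idx) z) x = F i) ->
  (exec (sum_prog v b a idx x0 x) e s).1 =
  set_store s a (map (ieval e) idx)
    (reval e s x0 + \sum_(i < ieval e b) F i).
Proof.
move=> idxE xE; rewrite exec_Seq.
apply: (@exec_For_ind v b _ e _ (fun N s' => s' =
   set_store s a (map (ieval e) idx) (reval e s x0 + \sum_(i < N) F i))).
  by rewrite big_ord0 addr0.
move=> N s' lt_N ->; rewrite /= idxE xE // set_storeK.
by rewrite {2}/set_store !eqxx /= big_ord_recr addrA.
Qed.

Lemma fills_sum v b a idx x0 x e s f (F : nat -> R) :
  (forall i, map (ieval (set_env e v i)) idx = map (ieval e) idx) ->
  (forall D' i z, (i < ieval e b)%N -> reval (set_env e v i)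
      (set_store (write s a D' f) a (map (ieval e) idx) z) x = F i) ->
  (forall D', reval e (write s a D' f) x0 + \sum_(i < ieval e b) F i
     = f (map (ieval e) idx)) ->
  fills (sum_prog v b a idx x0 x) e s a (pred1 (map (ieval e) idx)) f.
Proof.
move=> idxE xE fE D'.
by rewrite (exec_sum _ idxE (fun i z => @xE D' i z)); apply: write_set.
Qed.

Lemma mx_arrayE p q (M : 'M[R]_(p, q)) (i : 'I_p) (j : 'I_q) :
  mx_array M [:: i : nat; j : nat] = M i j.
Proof. by rewrite /mx_array !valK. Qed.

End Writes.

(** * The programs *)

Local Notation nrows := (IVar 0).
Local Notation nvars := (IVar 1).
Local Notation level := (IVar 3).

(** In iteration t of the outer loop (index variable 4) the inverse of the
    trailing block of size t is extended by the position n - 1 - t. *)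
Definition pivot := ISub nvars (IAdd (IVar 4) (INat 1)).

(** Memory layout: aTmp 0 [t; i; j] holds the padded inverse for block size t,
    aPre 0 [t; i; 0] the direction w extending this block, aPre 1 [t; i; a] the
    map from dual solutions to primal corrections, aPre 2 [i; 0] the
    unconstrained minimizer at the root.  Separate cells for each t let the
    contents for smaller blocks persist.  The present program leaves
    out the unit vector in w, which [pivot_prog] adds. *)
Definition dir_prog :=
  For 5 nvars
    (sum_prog 6 nvars (aPre 0) [:: IVar 4; IVar 5; INat 0] (RInt 0)
       (RMul (RInt (-1))
          (RMul (RCell (aTmp 0) [:: IVar 4; IVar 5; IVar 6])
                (RCell aQ [:: IVar 6; pivot])))).

Definition pivot_prog :=
  Assign (aPre 0) [:: IVar 4; pivot; INat 0]
    (RAdd (RCell (aPre 0) [:: IVar 4; pivot; INat 0]) (RInt 1)).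

Definition curvature_prog :=
  sum_prog 5 nvars (aTmp 1) [::] (RInt 0)
    (RMul (RCell aQ [:: pivot; IVar 5])
          (RCell (aPre 0) [:: IVar 4; IVar 5; INat 0])).

Definition update_prog :=
  For 5 nvars (For 6 nvars
    (Assign (aTmp 0) [:: IAdd (IVar 4) (INat 1); IVar 5; IVar 6]
       (RAdd (RCell (aTmp 0) [:: IVar 4; IVar 5; IVar 6])
          (RDiv (RMul (RCell (aPre 0) [:: IVar 4; IVar 5; INat 0])
                      (RCell (aPre 0) [:: IVar 4; IVar 6; INat 0]))
             (RCell (aTmp 1) [::]))))).

Definition border_prog :=
  Seq dir_prog (Seq pivot_prog (Seq curvature_prog update_prog)).

(** There are n + 1 block sizes, including the empty block. *)
Definition dual_map_prog :=
  For 4 (IAdd nvars (INat 1)) (For 5 nvars (For 6 nrows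
    (sum_prog 7 nvars (aPre 1) [:: IVar 4; IVar 5; IVar 6] (RInt 0)
       (RMul (RDiv (RInt (-1)) (RInt 2))
          (RMul (RCell (aTmp 0) [:: IVar 4; IVar 5; IVar 7])
                (RCell aA [:: IVar 6; IVar 7])))))).

Definition root_min_prog :=
  For 5 nvars
    (sum_prog 6 nvars (aPre 2) [:: IVar 5; INat 0] (RInt 0)
       (RMul (RDiv (RInt (-1)) (RInt 2))
          (RMul (RCell (aTmp 0) [:: nvars; IVar 5; IVar 6])
                (RCell ac [:: IVar 6; INat 0])))).

Definition pre_prog :=
  Seq (For 4 nvars border_prog) (Seq dual_map_prog root_min_prog).

Definition free_count := ISub nvars level.
Definition free_var := IAdd level (IVar 4).
Definition last_fixed := ISub level (INat 1).

(** The data handed to the children is the unconstrained minimizer, on the free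
    positions only: rewriting it on all n positions would cost O(n)
    also at deep nodes. *)
Definition min_prog :=
  IfI level (INat 0)
    (For 4 free_count
       (Assign (aNode 0) [:: free_var; INat 0] (RCell (aPre 2) [:: free_var; INat 0])))
    (For 4 free_count
       (Assign (aNode 0) [:: free_var; INat 0]
          (RAdd (RCell (aParent 0) [:: free_var; INat 0])
             (RMul (RSub (RCell aFix [::])
                         (RCell (aParent 0) [:: last_fixed; INat 0]))
                   (RCell (aPre 0) [:: free_count; free_var; INat 0]))))).

Definition primal_prog :=
  For 4 free_count
    (sum_prog 5 nrows aX [:: IVar 4; INat 0]
       (RCell (aNode 0) [:: free_var; INat 0])
       (RMul (RCell (aPre 1) [:: free_count; free_var; IVar 5])
             (RCell aLambda [:: IVar 5; INat 0]))).

Definition node_prog := Seq min_prog primal_prog.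

(** * Correctness of the programs *)

Arguments mx_array : simpl never.
Arguments set_env e v k w /.
Arguments input_env R m n P l w /.
Arguments set_store R s a idx x a' idx' /.
Arguments write R s a D f a' x /.

Section Correctness.
Variables (R : realFieldType) (m n : nat) (P : miqp R m n).
Local Notation Q := (miqpQ P).

Definition layers p q (M : nat -> 'M[R]_(p, q)) (x : seq nat) : R :=
  if x is t :: ij then mx_array (M t) ij else 0.

Arguments layers : simpl never.

Definition has_input (s : store R) : Prop :=
  [/\ s aQ = mx_array Q, s ac = mx_array (miqpc P) & s aA = mx_array (miqpA P)].

Definition has_inverses (t : nat) (s : store R) : Prop :=
  forall t' i j, (t' <= t)%N -> (i < n)%N -> (j < n)%N ->
    s (aTmp 0) [:: t'; i; j] = layers (tail_inv Q) [:: t'; i; j].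

Definition has_dirs (t : nat) (s : store R) : Prop :=
  forall t' i, (t' < t)%N -> (i < n)%N ->
    s (aPre 0) [:: t'; i; 0%N] = layers (tail_dir Q) [:: t'; i; 0%N].

Lemma mx_array_sum p q r (M : 'M[R]_(p, q)) (N : 'M[R]_(q, r)) i j :
  (i < p)%N -> (j < r)%N ->
  mx_array (M *m N) [:: i; j] =
  \sum_(h < q) mx_array M [:: i; h : nat] * mx_array N [:: h : nat; j].
Proof.
move=> lt_ip lt_jr; rewrite -[i]/(val (Ordinal lt_ip)) -[j]/(val (Ordinal lt_jr)).
by rewrite mx_arrayE mxE; apply: eq_bigr => h _; rewrite !mx_arrayE.
Qed.

Lemma mx_array_col p (y : 'cV[R]_p) (i : 'I_p) :
  mx_array y [:: i : nat; 0%N] = y i 0.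
Proof. exact: (mx_arrayE y i 0). Qed.

(** Programs index arrays by natural numbers; this moves to ordinals, where
    matrix entries make sense. *)
Lemma lt_ord p i : (i < p)%N -> exists j : 'I_p, i = j.
Proof. by move=> lt_ip; exists (Ordinal lt_ip). Qed.

Local Notation step_env t := (set_env (input_env P 0) 4 t).

(** The loop fills row t with w - e_k, and the subsequent assignment corrects
    the one entry at k. *)
Lemma dir_correct t s : (t < n)%N ->
  has_input s -> has_inverses t s -> has_dirs t s ->
  let s' := (exec pivot_prog (step_env t) (exec dir_prog (step_env t) s).1).1 in
  [/\ has_input s', has_inverses t s' & has_dirs t.+1 s'].
Proof.
move=> lt_tn [sQ sc sA] sB sU.
pose k := (n - (t + 1))%N.
have lt_kn : (k < n)%N by rewrite /k; lia.
pose f1 := layers (fun t => - (tail_inv Q t *m (Q *m unit_vec R n (n - t.+1)))).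
have fill_dir : fills dir_prog (step_env t) s (aPre 0)
    (fun x => [exists i : 'I_n, pred1 [:: t; i : nat; 0%N] x]) f1.
  apply: (@fills_For _ 5 (IVar 1) _ _ s _ (fun j => pred1 [:: t; j; 0%N])) => j lt_jn.
  apply: (@fills_sum _ _ _ _ _ _ _ _ _ _
    (fun i => -1 * (mx_array (tail_inv Q t) [:: j; i] * mx_array Q [:: i; k]))) => //.
    by move=> D' i z lt_in; rewrite /= sQ sB.
  move=> D'; rewrite /= add0r /f1 /layers; have [{lt_jn}{}j ->] := lt_ord lt_jn.
  rewrite mx_array_col mxE mxE -sumrN; apply: eq_bigr => i _.
  rewrite mulN1r mx_arrayE -[k]/(val (Ordinal lt_kn)) mx_arrayE.
  have -> : (n - t.+1)%N = Ordinal lt_kn by rewrite /= /k addn1.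
  by rewrite mul_unit_vec !mxE.
rewrite (fills_exec fill_dir); split.
- by split; rewrite /= /set_store /write.
- by move=> t' i j le_t'; rewrite /=; apply: sB.
move=> t' i le_t' lt_in; rewrite /= -/k.
have row_t j : (j < n)%N -> [exists i : 'I_n, [:: t; j; 0%N] == [:: t; i : nat; 0%N]].
  by move=> lt_jn; apply/existsP; exists (Ordinal lt_jn).
rewrite row_t //.
have [->|ne_t't] := eqVneq t' t.
  rewrite row_t // !eqseq_cons eqxx andbT /=.
  rewrite /tail_dir /conj_dir /f1 /layers.
  have [{lt_in}{}i ->] := lt_ord lt_in.
  rewrite -[k in mx_array _ (k :: _)]/(val (Ordinal lt_kn)) !mx_array_col !mxE -/k.
  rewrite -[t.+1]addn1 -/k; have [eq_ik|_] := eqVneq (i : nat) k.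
    have -> : Ordinal lt_kn = i by apply: val_inj.
    by rewrite addrC.
  by rewrite add0r.
rewrite eqseq_cons (negPf ne_t't) /=.
case: existsP => [[j /eqP[]]|_]; first by move/eqP; rewrite (negPf ne_t't).
apply: sU => //; lia.
Qed.

Lemma border_correct t s : (t < n)%N ->
  has_input s -> has_inverses t s -> has_dirs t s ->
  let s' := (exec border_prog (step_env t) s).1 in
  [/\ has_input s', has_inverses t.+1 s' & has_dirs t.+1 s'].
Proof.
move=> lt_tn s_in s_inv s_dir; rewrite /border_prog 3!exec_Seq.
have [] := dir_correct lt_tn s_in s_inv s_dir.
move: (exec pivot_prog _ _).1 => {s s_in s_inv s_dir} s [sQ sc sA] sB sU.
pose k := (n - (t + 1))%N; pose w := tail_dir Q t.
have lt_kn : (k < n)%N by rewrite /k; lia.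
have -> : (exec curvature_prog (step_env t) s).1 =
    set_store s (aTmp 1) [::] (curvature Q k w).
  rewrite /curvature_prog (@exec_sum _ _ _ _ _ _ _ _ _
    (fun i => mx_array Q [:: k; i] * mx_array w [:: i; 0%N])) //.
    rewrite /= add0r -[k]/(val (Ordinal lt_kn)) curvatureE mxE.
    congr set_store; apply: eq_bigr => i _.
    by rewrite mx_arrayE mx_array_col.
  by move=> i z lt_in; rewrite /= sQ sU.
set s1 := set_store _ _ _ _.
have fill_inv : fills update_prog (step_env t) s1 (aTmp 0)
    (fun x => [exists i : 'I_n, exists j : 'I_n, x == [:: t.+1; i : nat; j : nat]])
    (layers (tail_inv Q)).
  apply: (@fills_For _ 5 (IVar 1) _ _ _ _
    (fun i x => [exists j : 'I_n, x == [:: t.+1; i; j : nat]])) => i lt_in.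
  apply: (@fills_For _ 6 (IVar 1) _ _ _ _
    (fun j => pred1 [:: t.+1; i; j])) => j lt_jn.
  rewrite -[t.+1]addn1; apply: fills_Assign => D'; rewrite /s1 /=.
  rewrite !sU // sB // if_same /layers !addn1 {D'}.
  have {}lt_jn : (j < n)%N := lt_jn.
  have [{lt_jn}{}j ->] := lt_ord lt_jn; have [{lt_in}{}i ->] := lt_ord lt_in.
  rewrite !mx_arrayE !mx_array_col /= /border_inv [RHS]mxE [X in _ = _ + X]mxE.
  rewrite [(_ *m _^T) i j]mxE big_ord1 [_^T _ _]mxE -/(tail_dir Q t) mulrC.
  by rewrite /k addn1.
rewrite (fills_exec fill_inv); split.
- by split.
- move=> t' i j le_t' lt_in lt_jn /=; case: ifP => // /existsP no_ij.
  apply: sB => //; rewrite leqNgt; apply/negP => lt_tt'.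
  have {lt_tt'} eq_t' : t' = t.+1 by apply/eqP; rewrite eqn_leq le_t' lt_tt'.
  case: no_ij; exists (Ordinal lt_in); apply/existsP; exists (Ordinal lt_jn).
  by rewrite eq_t'.
- by move=> t' i lt_t' lt_in; apply: sU.
Qed.

Definition root_min : 'cV[R]_n := - 2^-1 *: (tail_inv Q n *m miqpc P).

Definition preprocessed (s : store R) : Prop :=
  [/\ has_dirs n s,
      forall t i a, (t <= n)%N -> (i < n)%N -> (a < m)%N ->
        s (aPre 1) [:: t; i; a] = layers (dual_map P) [:: t; i; a]
    & forall i, (i < n)%N ->
        s (aPre 2) [:: i; 0%N] = mx_array root_min [:: i; 0%N]].

Lemma preprocess_correct : preprocessed (preprocess P pre_prog).1.
Proof.
rewrite /preprocess /pre_prog 2!exec_Seq.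
have : let s' := (exec (For 4 (IVar 1) border_prog) (input_env P 0)
                    (input_store P)).1 in
       [/\ has_input s', has_inverses n s' & has_dirs n s'].
  apply: (@exec_For_ind _ 4 (IVar 1) _ _ _
    (fun t s => [/\ has_input s, has_inverses t s & has_dirs t s])).
    split=> // t i j; rewrite leqn0 => /eqP-> lt_in lt_jn.
    have [{lt_in}{}i ->] := lt_ord lt_in; have [{lt_jn}{}j ->] := lt_ord lt_jn.
    by rewrite /layers mx_arrayE /= mxE.
  by move=> t s lt_tn []; apply: border_correct.
move: (exec (For 4 (IVar 1) border_prog) _ _).1 => s [[sQ sc sA] sB sU].
have fill_map : fills dual_map_prog (input_env P 0) s (aPre 1)
    (fun x => [exists t : 'I_(n + 1), exists i : 'I_n, exists a : 'I_m,
       x == [:: t : nat; i : nat; a : nat]])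
    (layers (dual_map P)).
  apply: (@fills_For _ 4 (IAdd (IVar 1) (INat 1)) _ _ _ _
    (fun t x => [exists i : 'I_n, exists a : 'I_m,
       x == [:: t; i : nat; a : nat]])) => t lt_tn1.
  have {}lt_tn1 : (t < n + 1)%N := lt_tn1.
  have le_tn : (t <= n)%N by lia.
  apply: (@fills_For _ 5 (IVar 1) _ _ _ _
    (fun i x => [exists a : 'I_m, x == [:: t; i; a : nat]])) => i lt_in.
  have {}lt_in : (i < n)%N := lt_in.
  apply: (@fills_For _ 6 (IVar 0) _ _ _ _ (fun a => pred1 [:: t; i; a])) => a lt_am.
  have {}lt_am : (a < m)%N := lt_am.
  apply: (@fills_sum _ _ _ _ _ _ _ _ _ _ (fun j => -1 / 2 *
    (mx_array (tail_inv Q t) [:: i; j] * mx_array (miqpA P) [:: a; j]))) => //.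
    by move=> D' j z lt_jn; rewrite /= sA sB.
  move=> D' /=; rewrite add0r /layers.
  have [{lt_in}{}i ->] := lt_ord lt_in; have [{lt_am}{}a ->] := lt_ord lt_am.
  rewrite mx_arrayE mxE mxE mulr_sumr; apply: eq_bigr => j _.
  by rewrite !mx_arrayE mulN1r mxE.
rewrite (fills_exec fill_map); set s1 := write _ _ _ _.
have fill_min : fills root_min_prog (input_env P 0) s1 (aPre 2)
    (fun x => [exists i : 'I_n, pred1 [:: i : nat; 0%N] x]) (mx_array root_min).
  apply: (@fills_For _ 5 (IVar 1) _ _ _ _ (fun i => pred1 [:: i; 0%N])) => i lt_in.
  have {}lt_in : (i < n)%N := lt_in.
  apply: (@fills_sum _ _ _ _ _ _ _ _ _ _ (fun j => -1 / 2 *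
    (mx_array (tail_inv Q n) [:: i; j] * mx_array (miqpc P) [:: j; 0%N]))) => //.
    by move=> D' j z lt_jn; rewrite /s1 /= sc sB.
  move=> D' /=; rewrite add0r.
  have [{lt_in}{}i ->] := lt_ord lt_in.
  rewrite mx_array_col mxE mxE mulr_sumr; apply: eq_bigr => j _.
  by rewrite mx_arrayE mx_array_col mulN1r.
rewrite (fills_exec fill_min) /s1; split.
- by move=> t i lt_tn lt_in; apply: sU.
- move=> t i a le_tn lt_in lt_am /=; case: existsP => // -[].
  have lt_tn1 : (t < n + 1)%N by rewrite addn1.
  exists (Ordinal lt_tn1); apply/existsP; exists (Ordinal lt_in).
  by apply/existsP; exists (Ordinal lt_am).
- move=> i lt_in /=; case: existsP => // -[].
  by exists (Ordinal lt_in).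
Qed.

Section Node.
Variables (v : nat -> R) (l : nat).
Hypothesis lt_ln : (l < n)%N.
Local Notation tmin l := (tail_min Q (miqpc P) v l).

(** The parent knows its minimizer from position l - 1 on, which is just enough:
    the entry l - 1 is the one that the new fixing overrides. *)
Lemma min_correct s : preprocessed s ->
  ((0 < l)%N -> s aFix [::] = v l.-1 /\
     forall i, (l.-1 <= i < n)%N ->
       s (aParent 0) [:: i; 0%N] = mx_array (tmin l.-1) [:: i; 0%N]) ->
  fills min_prog (input_env P l) s (aNode 0)
    (fun x => [exists i : 'I_(n - l), x == [:: (l + i)%N; 0%N]])
    (mx_array (tmin l)).
Proof.
move=> [sU _ sR] parent; apply: fills_IfI => [|l_gt0].
  rewrite leqn0 => /eqP /= l0.
  apply: (@fills_For _ 4 free_count _ _ _ _ (fun i => pred1 [:: (l + i)%N; 0%N])).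
  move=> i lt_i; apply: fills_Assign => D' /=.
  rewrite sR; last by move: lt_i => /=; lia.
  by rewrite l0.
apply: (@fills_For _ 4 free_count _ _ _ _ (fun i => pred1 [:: (l + i)%N; 0%N])).
move=> i lt_i; apply: fills_Assign => D' /=.
have {}lt_i : (i < n - l)%N := lt_i.
have {}l_gt0 : (0 < l)%N := l_gt0.
have lt_lin : (l + i < n)%N by lia.
have [-> sP] := parent l_gt0.
rewrite !sP ?sU ?subn1; try lia.
have -> : tmin l = tmin l.-1 +
    (v l.-1 - ((unit_vec R n l.-1)^T *m tmin l.-1) 0 0) *: tail_dir Q (n - l).
  by rewrite -[in LHS](prednK l_gt0) /= prednK.
rewrite /layers.
have lt_l1n : (l.-1 < n)%N by lia.
have [j ->] := lt_ord lt_lin; rewrite !mx_array_col [RHS]mxE [X in _ = _ + X]mxE.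
rewrite -[l.-1]/(val (Ordinal lt_l1n)) unit_vec_coord mx_array_col //.
Qed.

Lemma node_correct s (lam : 'cV[R]_m) : preprocessed s ->
  s aLambda = mx_array lam ->
  ((0 < l)%N -> s aFix [::] = v l.-1 /\
     forall i, (l.-1 <= i < n)%N ->
       s (aParent 0) [:: i; 0%N] = mx_array (tmin l.-1) [:: i; 0%N]) ->
  let s' := (exec node_prog (input_env P l) s).1 in
  (forall i, (l <= i < n)%N ->
     s' (aNode 0) [:: i; 0%N] = mx_array (tmin l) [:: i; 0%N]) /\
  (forall i : 'I_(n - l), s' aX [:: i : nat; 0%N] =
     tmin l (tail_ord i) 0 + (dual_map P (n - l) *m lam) (tail_ord i) 0).
Proof.
move=> pre sL parent; rewrite /node_prog exec_Seq.
rewrite (fills_exec (min_correct pre parent)); have [_ sW _] := pre.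
set s1 := write _ _ _ _.
have s1N i : (l <= i < n)%N ->
    s1 (aNode 0) [:: i; 0%N] = mx_array (tmin l) [:: i; 0%N].
  move=> /andP[le_li lt_in]; rewrite /s1 /=; case: existsP => // -[].
  have lt_il : (i - l < n - l)%N by lia.
  by exists (Ordinal lt_il); rewrite /= subnKC.
pose x i := mx_array (tmin l) [:: (l + i)%N; 0%N]
   + mx_array (dual_map P (n - l) *m lam) [:: (l + i)%N; 0%N].
have fill_x : fills primal_prog (input_env P l) s1 aX
    (fun y => [exists i : 'I_(n - l), pred1 [:: i : nat; 0%N] y])
    (fun y => x (nth 0%N y 0)).
  apply: (@fills_For _ 4 free_count _ _ _ _ (fun i => pred1 [:: i; 0%N])) => i lt_i.
  have {}lt_i : (i < n - l)%N := lt_i.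
  have lt_lin : (l + i < n)%N by lia.
  apply: (@fills_sum _ _ _ _ _ _ _ _ _ _ (fun a =>
    mx_array (dual_map P (n - l)) [:: (l + i)%N; a] * mx_array lam [:: a; 0%N])) => //.
    by move=> D' a z lt_am; rewrite /s1 /= sL sW ?leq_subr.
  by move=> D'; rewrite [reval _ _ _]/= s1N ?leq_addr // /x mx_array_sum.
rewrite (fills_exec fill_x); split=> [i le_li|i]; first exact: s1N.
rewrite /=; case: existsP => [_|[]]; last by exists i.
rewrite /x -[(l + i)%N]/(val (tail_ord i)) !mx_array_col //.
Qed.

End Node.
End Correctness.

Local Close Scope ring_scope.

(** * The time bounds and the theorem *)

Lemma pre_time (R : realFieldType) m n (P : miqp R m n) :
  time pre_prog (input_env P 0) <= weight pre_prog * (m + n).+1 ^ depth pre_prog.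
Proof.
apply: time_le_weight => //=; rewrite /input_env /=.
by repeat (split=> [|*]); rewrite ?addn1 ?ltnS ?leq_addl // leqW ?leq_addl ?leq_addr.
Qed.

Lemma node_time (R : realFieldType) m n (P : miqp R m n) l : l < n ->
  time node_prog (input_env P l) <= 100 * (maxn 1 m * (n - l)).
Proof.
move=> lt_ln; rewrite /= !sum_nat_const !card_ord /=.
set q := n - l; have q_gt0 : 0 < q by rewrite subn_gt0.
set M := maxn 1 m.
have lenM : q <= M * q by rewrite leq_pmull // leq_max.
have lemM : q * m <= M * q by rewrite mulnC leq_mul2r leq_maxr orbT.
case: ifP => _ ; nia.
Qed.

(** What a node inherits is the unconstrained minimizer of its parent, and the
    recursion of [tail_min] has the same shape. *)
Lemma node_comp_correct (R : realFieldType) m n (P : miqp R m n)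
    (lam : seq int -> 'cV[R]_m) (r : seq int) l (lt_ln : l < n) :
  let y := tail_min (miqpQ P) (miqpc P) (fixval R r) l in
  let s := (node_comp P node_prog (preprocess P pre_prog).1 lam r l).1 in
  (forall i, l <= i < n -> s (aNode 0) [:: i; 0] = mx_array y [:: i; 0]) /\
  (forall i : 'I_(n - l), s aX [:: i : nat; 0] =
     (y (tail_ord i) ord0
     + (dual_map P (n - l) *m lam (take l r)) (tail_ord i) ord0)%R).
Proof.
have pre := preprocess_correct P.
elim: l lt_ln => [|l IHl] lt_ln.
  rewrite take0.
  exact: (@node_correct _ _ _ P (fixval R r) 0 lt_ln
    (node_store (preprocess P pre_prog).1 (@zero_store R) 0%R (lam [::])) (lam [::])
    pre erefl).
have [parent _] := IHl (ltnW lt_ln).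
have := @node_correct R m n P (fixval R r) l.+1 lt_ln
  (node_store (preprocess P pre_prog).1
     (node_comp P node_prog (preprocess P pre_prog).1 lam r l).1
     (fixval R r l) (lam (take l.+1 r))) (lam (take l.+1 r)) pre erefl.
apply=> _; split=> //.
Qed.

Theorem theorem3p4 (R : realType) :
  exists (pre node : prog) (K k C : nat),
    forall (m n : nat) (P : miqp R m n),
      (miqp_n1 P <= n)%N -> posdef (miqpQ P) ->
      (preprocess P pre).2 <= K * (m + n).+1 ^ k /\
      forall (lam : seq int -> 'cV[R]_m) (r : seq int),
        (size r < miqp_n1 P)%N ->
        (forall l : nat, (l <= size r)%N ->
           dual_optimal P (take l r) (lam (take l r))) ->
        let st := node_comp P node (preprocess P pre).1 lam r (size r) in
        unique (@relax_optimal R m n P r) (output n (size r) st.1) /\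
        st.2 <= C * (maxn 1 m * (n - size r)).
Proof.
exists pre_prog, node_prog, (weight pre_prog), (depth pre_prog), 100.
move=> m n P le_n1n posQ; split.
  exact: leq_trans (exec_time _ _ _) (pre_time P).
move=> lam r lt_rn1 lam_opt st.
have lt_rn : size r < n := leq_trans lt_rn1 le_n1n.
split.
  have := lam_opt _ (leqnn _); rewrite take_size => lam_r.
  apply: (relax_optimal_from_dual posQ (ltnW lt_rn) lam_r) => i.
  have [_ xE] := node_comp_correct P lam r lt_rn.
  by rewrite mxE xE take_size.
apply: leq_trans (node_time P lt_rn).
by rewrite /st; case: (size r) => [|l]; apply: exec_time.
Qed.
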